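(* Let $0 < p < 1$ and put $$\alpha = \frac{p^3 (2 + p)}{1 + 2p}, \qquad \beta = \frac{27}{4}\, \frac{p^2 (1+p)^2}{(1 + p + p^2)^3}.$$ Then $$\frac{F_2(1 - \alpha)}{F_2(\alpha)} = \sqrt{3}\; \frac{F_3(1 - \beta)}{F_3(\beta)}.$$
   Context: $F(a,b;c;x) = {}_2F_1(a,b;c;x) = \sum_{n\ge 0} \frac{(a)_n (b)_n}{(c)_n\, n!} x^n$ is the Gauss hypergeometric function, where $(a)_n = a(a+1)\cdots(a+n-1)$. Abbreviations: $F_2(x) = F(\tfrac12, \tfrac12; 1; x)$ and $F_3(x) = F(\tfrac13, \tfrac23; 1; x)$. *)

(* Defs.v *)
From Stdlib Require Import Factorial Reals.
From Coquelicot Require Import Coquelicot.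
Local Open Scope R_scope.

(** Rising factorial [(a)_n = a (a+1) ... (a+n-1)]. *)
Fixpoint pochhammer (a : R) (n : nat) : R :=
  match n with
  | O => 1
  | S m => pochhammer a m * (a + INR m)
  end.

(** Gauss hypergeometric series for real parameters and argument, intended for
    [c] not a non-positive integer and [Rabs x < 1]; elsewhere the value is
    whatever the total functions [Rdiv] and [PSeries] return. *)
Definition hypergeom_2F1 (a b c x : R) : R :=
  PSeries (fun n => pochhammer a n * pochhammer b n
                    / (pochhammer c n * INR (fact n))) x.

Definition F2 (x : R) : R := hypergeom_2F1 (1 / 2) (1 / 2) 1 x.

Definition F3 (x : R) : R := hypergeom_2F1 (1 / 3) (2 / 3) 1 x.

(* Main.v *)
(** The series [F = 2F1(a,b;1;.)] with [a + b = 1] and [G = x (1 - x) F'] satisfy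
    the first-order system [x (1 - x) F' = G], [G' = a b F], which is preserved by
    [x -> 1 - x], [G -> - G]. Pulled back along [p -> alpha] and [p -> beta], the
    systems for [F2] and [F3] are gauge equivalent through the multiplier
    [m = (1 + p + p^2) / sqrt (1 + 2 p)]: the Wronskian of [m F2(alpha)] and
    [F3(beta)], weighted so as to be constant, vanishes at [p = 0], where both
    functions are regular, so that [F3(beta) / (m F2(alpha))] is constant, equal
    to [1 / m(0) = 1]. The same argument started from [p = 1] gives
    [F3(1 - beta) / (m F2(1 - alpha)) = 1 / m(1) = 1 / sqrt 3]. *)

Require Import Defs.
From Stdlib Require Import Reals Lra Lia Factorial.
From Coquelicot Require Import Coquelicot.
Local Open Scope R_scope.

(** The ends come in either order because the base point [a] will be 0, left of the target, or 1,
    right of it. Derivatives are asked for only in the open segment: the pulled-back systems are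
    singular at 0 and 1. *)
Lemma null_derive_segment (f : R -> R) (a b : R) :
  (forall x, Rmin a b < x < Rmax a b -> is_derive f x 0) ->
  (forall x, Rmin a b <= x <= Rmax a b -> continuous f x) ->
  f b = f a.
Proof.
  intros Hd Hc.
  destruct (MVT_gen f a b (fun _ => 0)) as [c [_ Hf]].
  - exact Hd.
  - intros x Hx. apply continuity_pt_filterlim, Hc, Hx.
  - lra.
Qed.

(** * Gauss series with a + b = c = 1 *)

Definition gauss_coef (a b : R) (n : nat) : R :=
  pochhammer a n * pochhammer b n / (pochhammer 1 n * INR (fact n)).

(** This is G = x (1 - x) F', encoded as a b times the antiderivative of F. So G' = a b F and G(0) =
    0 are immediate, and only G = x (1 - x) F' needs the recurrence for the coefficients. *)
Definition gauss_flux (a b x : R) : R :=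
  a * b * PSeries (PS_Int (gauss_coef a b)) x.

Lemma pochhammer_pos (a : R) (n : nat) : 0 < a -> 0 < pochhammer a n.
Proof.
  intros Ha. induction n as [|n IH]; simpl; [lra|].
  pose proof (pos_INR n). apply Rmult_lt_0_compat; lra.
Qed.

Lemma gauss_coef_pos (a b : R) (n : nat) :
  0 < a -> 0 < b -> 0 < gauss_coef a b n.
Proof.
  intros Ha Hb. unfold gauss_coef.
  apply Rdiv_lt_0_compat; apply Rmult_lt_0_compat;
    try (apply pochhammer_pos; lra).
  apply INR_fact_lt_0.
Qed.

Lemma gauss_coef_S (a b : R) (n : nat) :
  (INR n + 1) ^ 2 * gauss_coef a b (S n)
  = (a + INR n) * (b + INR n) * gauss_coef a b n.
Proof.
  unfold gauss_coef. rewrite fact_simpl, mult_INR, S_INR. simpl pochhammer.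
  pose proof (pos_INR n). pose proof (INR_fact_lt_0 n).
  pose proof (pochhammer_pos 1 n Rlt_0_1).
  field. lra.
Qed.

Section Gauss.

Variables a b : R.
Hypotheses (ha : 0 < a) (hb : 0 < b) (hab : a + b = 1).

(** Since a + b = 1, the ratio of consecutive coefficients is (n^2 + n + a b) / (n + 1)^2 <= 1. The
    bound makes the radius of convergence at least 1. *)
Lemma gauss_coef_le_1 (n : nat) : gauss_coef a b n <= 1.
Proof.
  induction n as [|n IH].
  - unfold gauss_coef. simpl. lra.
  - pose proof (gauss_coef_S a b n) as H.
    pose proof (gauss_coef_pos a b n ha hb).
    pose proof (pos_INR n).
    apply Rmult_le_reg_l with ((INR n + 1) ^ 2); [nra|].
    rewrite H. replace b with (1 - a) in * by lra. nra.
Qed.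

Lemma gauss_CV_radius (x : R) :
  Rabs x < 1 -> Rbar_lt (Rabs x) (CV_radius (gauss_coef a b)).
Proof.
  intros Hx. apply Rbar_lt_le_trans with (Finite 1); [exact Hx|].
  apply (proj1 (CV_radius_bounded (gauss_coef a b))).
  exists 1. intros n.
  rewrite pow1, Rmult_1_r, Rabs_pos_eq.
  - apply gauss_coef_le_1.
  - left. apply gauss_coef_pos; assumption.
Qed.

(** The coefficients are positive and the first is 1. This keeps the denominators, all built from
    [F2], away from zero. *)
Lemma gauss_ge_1 (x : R) : 0 <= x < 1 -> 1 <= hypergeom_2F1 a b 1 x.
Proof.
  intros Hx. unfold hypergeom_2F1. fold (gauss_coef a b).
  assert (Hr : Rbar_lt (Rabs x) (CV_radius (gauss_coef a b)))
    by (apply gauss_CV_radius; rewrite Rabs_pos_eq; lra).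
  pose proof (CV_disk_inside _ _ Hr) as Hs. apply ex_series_Rabs in Hs.
  unfold PSeries. rewrite (Series_incr_1 _ Hs).
  assert (0 <= Series (fun k => gauss_coef a b (S k) * x ^ S k)).
  { rewrite <- (PSeries_const_0 x). unfold PSeries.
    apply Series_le; [|exact (proj1 (ex_series_incr_1 _) Hs)].
    intros n. rewrite Rmult_0_l. split; [lra|]. apply Rmult_le_pos.
    - left. apply gauss_coef_pos; assumption.
    - apply pow_le; lra. }
  replace (gauss_coef a b 0 * x ^ 0) with 1 by (unfold gauss_coef; simpl; field).
  lra.
Qed.

Lemma gauss_0 : hypergeom_2F1 a b 1 0 = 1.
Proof.
  unfold hypergeom_2F1. rewrite PSeries_0. simpl. field.
Qed.

Lemma gauss_flux_0 : gauss_flux a b 0 = 0.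
Proof.
  unfold gauss_flux. rewrite PSeries_0. simpl. ring.
Qed.

Lemma is_derive_gauss_flux (x : R) : Rabs x < 1 ->
  is_derive (gauss_flux a b) x (a * b * hypergeom_2F1 a b 1 x).
Proof.
  intros Hx. unfold gauss_flux, hypergeom_2F1. fold (gauss_coef a b).
  apply (is_derive_scal (PSeries (PS_Int (gauss_coef a b)))).
  rewrite (PSeries_ext (gauss_coef a b) (PS_derive (PS_Int (gauss_coef a b)))).
  - apply is_derive_PSeries. rewrite CV_radius_Int. apply gauss_CV_radius, Hx.
  - intros n. unfold PS_derive, PS_Int. field. apply not_0_INR. discriminate.
Qed.

(** Compare coefficients c_n of F: x (1 - x) F' has (n + 1) c_{n+1} - n c_n at x^(n+1), which by
    [gauss_coef_S] and a + b = 1 equals a b c_n / (n + 1). *)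
Lemma gauss_flux_eq (x : R) : Rabs x < 1 ->
  gauss_flux a b x = x * (1 - x) * PSeries (PS_derive (gauss_coef a b)) x.
Proof.
  intros Hx.
  set (d := PS_derive (gauss_coef a b)).
  assert (Hd : ex_pseries d x)
    by (apply ex_pseries_derive, gauss_CV_radius, Hx).
  replace (x * (1 - x) * PSeries d x)
    with (PSeries (PS_minus (PS_incr_1 d) (PS_incr_1 (PS_incr_1 d))) x).
  2:{ rewrite (PSeries_minus (PS_incr_1 d) (PS_incr_1 (PS_incr_1 d))).
      - rewrite (PSeries_incr_1 (PS_incr_1 d)), (PSeries_incr_1 d). ring.
      - apply (ex_pseries_incr_1 d), Hd.
      - apply (ex_pseries_incr_1 (PS_incr_1 d)), (ex_pseries_incr_1 d), Hd. }
  unfold gauss_flux. rewrite <- PSeries_scal.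
  apply PSeries_ext. intros n.
  unfold PS_scal, PS_minus, PS_plus, PS_opp, scal, plus, opp; simpl.
  unfold mult; simpl.
  destruct n as [|n]; [unfold zero; simpl; ring|].
  (* At [n = 0] the shift inserts [zero], which agrees with the factor [INR n]. *)
  assert (Hn : PS_incr_1 d n = INR n * gauss_coef a b n).
  { destruct n as [|n]; [unfold zero; simpl; unfold zero; simpl; ring|reflexivity]. }
  simpl PS_incr_1 in *. rewrite Hn. unfold d, PS_derive, PS_Int.
  pose proof (gauss_coef_S a b n) as H. rewrite S_INR.
  pose proof (pos_INR n).
  apply Rmult_eq_reg_l with (INR n + 1); [|lra].
  transitivity ((INR n + 1) ^ 2 * gauss_coef a b (S n)
                - INR n * (INR n + 1) * gauss_coef a b n); [|ring].
  rewrite H. replace b with (1 - a) by lra. field. lra.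
Qed.

Lemma is_derive_gauss (x : R) : 0 < x < 1 ->
  is_derive (hypergeom_2F1 a b 1) x (gauss_flux a b x / (x * (1 - x))).
Proof.
  intros Hx.
  assert (Hx1 : Rabs x < 1) by (rewrite Rabs_pos_eq; lra).
  rewrite (gauss_flux_eq x Hx1).
  replace (_ / _) with (PSeries (PS_derive (gauss_coef a b)) x) by (field; lra).
  apply is_derive_PSeries, gauss_CV_radius, Hx1.
Qed.

Lemma continuous_gauss (x : R) : Rabs x < 1 ->
  continuous (hypergeom_2F1 a b 1) x.
Proof.
  intros Hx. apply (@ex_derive_continuous R_AbsRing R_NormedModule).
  eexists. apply is_derive_PSeries, gauss_CV_radius, Hx.
Qed.

Lemma continuous_gauss_flux (x : R) : Rabs x < 1 ->
  continuous (gauss_flux a b) x.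
Proof.
  intros Hx. apply (@ex_derive_continuous R_AbsRing R_NormedModule).
  eexists. apply is_derive_gauss_flux, Hx.
Qed.

End Gauss.

(** * Cubic transformation *)

Definition cubic_alpha (p : R) : R := p ^ 3 * (2 + p) / (1 + 2 * p).
Definition cubic_beta (p : R) : R :=
  27 / 4 * (p ^ 2 * (1 + p) ^ 2 / (1 + p + p ^ 2) ^ 3).

Definition dalpha (p : R) : R := 6 * p ^ 2 * (1 + p) ^ 2 / (1 + 2 * p) ^ 2.
Definition dbeta (p : R) : R :=
  27 / 4 * (p * (1 + p) * (1 + 2 * p) * (1 - p) * (2 + p) / (1 + p + p ^ 2) ^ 4).

(** [alpha (1 - alpha) / alpha'] and [beta (1 - beta) / beta']. *)
Definition weight_alpha (p : R) : R := p * (1 - p) * (1 + p) * (2 + p) / 6.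
Definition weight_beta (p : R) : R :=
  p * (1 - p) * (1 + p) * (2 + p) * (1 + 2 * p) / (4 * (1 + p + p ^ 2) ^ 2).

Definition multiplier (p : R) : R := (1 + p + p ^ 2) / sqrt (1 + 2 * p).
Definition dlog_multiplier (p : R) : R :=
  (1 + 2 * p) / (1 + p + p ^ 2) - 1 / (1 + 2 * p).

Lemma is_derive_alpha (p : R) : 0 <= p -> is_derive cubic_alpha p (dalpha p).
Proof.
  intros Hp. unfold cubic_alpha, dalpha. auto_derive; [lra|]. field. lra.
Qed.

Lemma is_derive_beta (p : R) : 0 <= p -> is_derive cubic_beta p (dbeta p).
Proof.
  intros Hp. unfold cubic_beta, dbeta.
  assert (1 + p + p ^ 2 <> 0) by nra.
  auto_derive; [|field; nra].
  replace (1 + p + p * (p * 1)) with (1 + p + p ^ 2) by ring.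
  repeat apply Rmult_integral_contrapositive_currified; lra.
Qed.

Lemma multiplier_pos (p : R) : 0 <= p -> 0 < multiplier p.
Proof.
  intros Hp. apply Rdiv_lt_0_compat; [nra|]. apply sqrt_lt_R0. lra.
Qed.

Lemma is_derive_multiplier (p : R) : 0 <= p ->
  is_derive multiplier p (multiplier p * dlog_multiplier p).
Proof.
  intros Hp. unfold multiplier, dlog_multiplier.
  assert (Hs : 0 < sqrt (1 + 2 * p)) by (apply sqrt_lt_R0; lra).
  assert (Hss : sqrt (1 + 2 * p) * sqrt (1 + 2 * p) = 1 + 2 * p)
    by (apply sqrt_sqrt; lra).
  auto_derive; [lra|].
  set (s := sqrt (1 + 2 * p)) in *.
  replace (1 / (1 + 2 * p)) with (1 / (s * s)) by (rewrite Hss; reflexivity).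
  field. nra.
Qed.

Lemma one_minus_alpha (p : R) : 0 <= p ->
  1 - cubic_alpha p = (1 - p) * (1 + p) ^ 3 / (1 + 2 * p).
Proof. intros Hp. unfold cubic_alpha. field. lra. Qed.

(** The cubic t^3 - (1 + p + p^2) t + p (1 + p) has roots 1, p, -1 - p. Its discriminant 4 (1 + p +
    p^2)^3 - 27 p^2 (1 + p)^2 is thus the square of the product of the root differences 1 - p, 2 +
    p, 1 + 2 p. *)
Lemma one_minus_beta (p : R) :
  1 - cubic_beta p
  = ((1 - p) * (2 + p) * (1 + 2 * p)) ^ 2 / (4 * (1 + p + p ^ 2) ^ 3).
Proof. unfold cubic_beta. field. nra. Qed.

Lemma alpha_weight (p : R) : 0 <= p ->
  cubic_alpha p * (1 - cubic_alpha p) = dalpha p * weight_alpha p.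
Proof.
  intros Hp. unfold cubic_alpha, dalpha, weight_alpha. field. lra.
Qed.

Lemma beta_weight (p : R) :
  cubic_beta p * (1 - cubic_beta p) = dbeta p * weight_beta p.
Proof.
  unfold cubic_beta, dbeta, weight_beta. field. nra.
Qed.

Lemma alpha_ge_0 (p : R) : 0 <= p -> 0 <= cubic_alpha p.
Proof.
  intros Hp. unfold cubic_alpha.
  apply Rle_mult_inv_pos; [|lra].
  apply Rmult_le_pos; [apply pow_le|]; lra.
Qed.

Lemma beta_ge_0 (p : R) : 0 <= cubic_beta p.
Proof.
  unfold cubic_beta.
  apply Rmult_le_pos; [lra|]. apply Rle_mult_inv_pos.
  - apply Rmult_le_pos; apply pow2_ge_0.
  - apply pow_lt. nra.
Qed.

Lemma alpha_lt_1 (p : R) : 0 <= p < 1 -> cubic_alpha p < 1.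
Proof.
  intros Hp.
  enough (0 < 1 - cubic_alpha p) by lra.
  rewrite one_minus_alpha by lra.
  apply Rdiv_lt_0_compat; [|lra].
  apply Rmult_lt_0_compat; [|apply pow_lt]; lra.
Qed.

Lemma beta_lt_1 (p : R) : 0 <= p < 1 -> cubic_beta p < 1.
Proof.
  intros Hp.
  enough (0 < 1 - cubic_beta p) by lra.
  rewrite one_minus_beta.
  apply Rdiv_lt_0_compat.
  - apply pow_lt. repeat apply Rmult_lt_0_compat; lra.
  - apply Rmult_lt_0_compat; [lra|apply pow_lt; nra].
Qed.

Lemma alpha_gt_0 (p : R) : 0 < p -> 0 < cubic_alpha p.
Proof.
  intros Hp. unfold cubic_alpha.
  apply Rdiv_lt_0_compat; [|lra].
  apply Rmult_lt_0_compat; [apply pow_lt|]; lra.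
Qed.

Lemma beta_gt_0 (p : R) : 0 < p -> 0 < cubic_beta p.
Proof.
  intros Hp. unfold cubic_beta.
  apply Rmult_lt_0_compat; [lra|]. apply Rdiv_lt_0_compat.
  - apply Rmult_lt_0_compat; apply pow_lt; lra.
  - apply pow_lt. nra.
Qed.

(** The Gauss system with [a * b = k] pulled back along [u], where [u' = du] and
    [w = u (1 - u) / u']. *)
Definition pullback_system (k : R) (du w f phi : R -> R) : Prop :=
  forall x, 0 < x < 1 ->
    is_derive f x (phi x / w x) /\ is_derive phi x (k * du x * f x).

Lemma pullback_system_comp (a b : R) (u du w : R -> R) :
  0 < a -> 0 < b -> a + b = 1 ->
  (forall x, 0 < x < 1 -> is_derive u x (du x)) ->
  (forall x, 0 < x < 1 -> 0 < u x < 1) ->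
  (forall x, 0 < x < 1 -> u x * (1 - u x) = du x * w x) ->
  pullback_system (a * b) du w
    (fun x => hypergeom_2F1 a b 1 (u x)) (fun x => gauss_flux a b (u x)).
Proof.
  intros Ha Hb Hab Hd Hu Hw x Hx.
  specialize (Hd x Hx). specialize (Hu x Hx). specialize (Hw x Hx).
  (* The product is u (1 - u) > 0, so neither factor vanishes. *)
  assert (Hn : du x * w x <> 0) by nra.
  split.
  - replace (gauss_flux a b (u x) / w x)
      with (scal (du x) (gauss_flux a b (u x) / (u x * (1 - u x)))).
    + apply (is_derive_comp (hypergeom_2F1 a b 1) u); [|exact Hd].
      apply is_derive_gauss; assumption.
    + rewrite Hw. unfold scal; simpl; unfold mult; simpl. field.
      split; intros E; rewrite E in Hn; lra.
  - replace (a * b * du x * hypergeom_2F1 a b 1 (u x))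
      with (scal (du x) (a * b * hypergeom_2F1 a b 1 (u x)))
      by (unfold scal; simpl; unfold mult; simpl; ring).
    apply (is_derive_comp (gauss_flux a b) u); [|exact Hd].
    apply is_derive_gauss_flux; try assumption. rewrite Rabs_pos_eq; lra.
Qed.

(** Replacing u by 1 - u negates u' and u (1 - u) / u'. Negating the flux as well restores the
    system of u itself, so both base points can share one Wronskian. *)
Lemma pullback_system_reflect (k : R) (du w f phi : R -> R) :
  pullback_system k (fun x => - du x) (fun x => - w x) f phi ->
  pullback_system k du w f (fun x => - phi x).
Proof.
  intros H x Hx. destruct (H x Hx) as [H1 H2]. split.
  - replace (- phi x / w x) with (phi x / - w x); [exact H1|].
    unfold Rdiv. rewrite Rinv_opp. ring.
  - replace (k * du x * f x) with (opp (k * - du x * f x))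
      by (unfold opp; simpl; ring).
    apply (is_derive_opp phi). exact H2.
Qed.

Lemma continuous_derivable (f : R -> R) (x l : R) :
  is_derive f x l -> continuous f x.
Proof.
  intros H. apply (@ex_derive_continuous R_AbsRing R_NormedModule).
  exists l. exact H.
Qed.

(** The weighted Wronskian [weight_beta * ((multiplier f) g' - (multiplier f)' g)];
    its last coefficient is [weight_beta / weight_alpha]. *)
Definition cubic_wronskian (f phi g gam : R -> R) (x : R) : R :=
  multiplier x *
  (gam x * f x - weight_beta x * dlog_multiplier x * f x * g x
   - 3 / 2 * (1 + 2 * x) / (1 + x + x ^ 2) ^ 2 * phi x * g x).

(** * Constancy of the Wronskian and of the quotient *)

Section Wronskian.

Variables f phi g gam : R -> R.
Hypothesis Hf : pullback_system (1 / 4) dalpha weight_alpha f phi.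
Hypothesis Hg : pullback_system (2 / 9) dbeta weight_beta g gam.

(** Expand by the product rule. The terms in [gam * f] and [gam * phi] cancel at once. Those in
    [phi * g] cancel because multiplier^2 * weight_beta / weight_alpha is the constant 3/2. In
    [f * g] there remains a rational identity in x, which is the gauge equivalence of the two
    equations. *)
Lemma cubic_wronskian_derive (x : R) : 0 < x < 1 ->
  is_derive (cubic_wronskian f phi g gam) x 0.
Proof.
  intros Hx.
  destruct (Hf x Hx) as [Df Dphi]. destruct (Hg x Hx) as [Dg Dgam].
  pose proof (is_derive_multiplier x ltac:(lra)) as Dm.
  assert (Hq : 1 + x + x ^ 2 <> 0) by nra.
  unfold cubic_wronskian, dlog_multiplier, weight_beta.
  auto_derive.
  - repeat split; try (eexists; eassumption);
      repeat apply Rmult_integral_contrapositive_currified; nra.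
  - rewrite (is_derive_unique (fun y : R => multiplier y) _ _ Dm),
      (is_derive_unique (fun y : R => f y) _ _ Df),
      (is_derive_unique (fun y : R => phi y) _ _ Dphi),
      (is_derive_unique (fun y : R => g y) _ _ Dg),
      (is_derive_unique (fun y : R => gam y) _ _ Dgam).
    unfold dlog_multiplier, dalpha, dbeta, weight_alpha, weight_beta.
    field. repeat split; nra.
Qed.

(** By the quotient rule the derivative is the Wronskian divided by
    [weight_beta x * (multiplier x * f x) ^ 2]. *)
Lemma cubic_quotient_derive (x : R) : 0 < x < 1 -> 0 < f x ->
  cubic_wronskian f phi g gam x = 0 ->
  is_derive (fun y => g y / (multiplier y * f y)) x 0.
Proof.
  intros Hx Hfx HW.
  destruct (Hf x Hx) as [Df _]. destruct (Hg x Hx) as [Dg _].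
  pose proof (is_derive_multiplier x ltac:(lra)) as Dm.
  pose proof (multiplier_pos x ltac:(lra)) as Hm.
  assert (Hw : 0 < weight_beta x).
  { apply Rdiv_lt_0_compat; [|nra].
    repeat apply Rmult_lt_0_compat; lra. }
  auto_derive.
  - repeat split; try (eexists; eassumption). nra.
  - rewrite (is_derive_unique (fun y : R => multiplier y) _ _ Dm),
      (is_derive_unique (fun y : R => f y) _ _ Df),
      (is_derive_unique (fun y : R => g y) _ _ Dg).
    transitivity (cubic_wronskian f phi g gam x
                  / (weight_beta x * (multiplier x * f x) ^ 2)).
    + unfold cubic_wronskian.
      (* Eliminating [weight_alpha] lets [field] treat [weight_beta x] as an atom. *)
      replace (phi x / weight_alpha x)
        with (3 / 2 * (1 + 2 * x) / (1 + x + x ^ 2) ^ 2 / weight_beta x * phi x).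
      * field. repeat split; nra.
      * unfold weight_alpha, weight_beta. field. repeat split; nra.
    + rewrite HW. field. repeat split; nra.
Qed.

Lemma cubic_quotient (e p : R) :
  0 < p < 1 -> e = 0 \/ e = 1 ->
  (forall x, Rmin e p <= x <= Rmax e p ->
     0 < f x /\ continuous f x /\ continuous phi x
     /\ continuous g x /\ continuous gam x) ->
  phi e = 0 -> gam e = 0 ->
  g p / (multiplier p * f p) = g e / (multiplier e * f e).
Proof.
  intros Hp He Hc Hphi Hgam.
  assert (Hin : forall x, Rmin e p < x < Rmax e p -> 0 < x < 1).
  { intros x. destruct He; subst e;
      [rewrite Rmin_left, Rmax_right | rewrite Rmin_right, Rmax_left]; lra. }
  assert (Hcl : forall x, Rmin e p <= x <= Rmax e p -> 0 <= x).
  { intros x. destruct He; subst e;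
      [rewrite Rmin_left, Rmax_right | rewrite Rmin_right, Rmax_left]; lra. }
  assert (HW : forall x, Rmin e p <= x <= Rmax e p ->
             cubic_wronskian f phi g gam x = 0).
  { intros x Hx.
    transitivity (cubic_wronskian f phi g gam e).
    (* The segment from e to x lies within the one from e to p, on whichever side of p the point e
       is. *)
    - assert (Rmin e p <= Rmin e x /\ Rmax e x <= Rmax e p).
      { revert Hx. unfold Rmin, Rmax.
        destruct (Rle_dec e p), (Rle_dec e x); lra. }
      apply null_derive_segment; intros y Hy.
      + apply cubic_wronskian_derive, Hin. lra.
      + assert (Hy' : Rmin e p <= y <= Rmax e p) by lra.
        destruct (Hc y Hy') as (_ & Cf & Cphi & Cg & Cgam).
        pose proof (Hcl y Hy') as Hy0.
        assert (Hq : 1 + y + y ^ 2 <> 0) by nra.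
        assert (Cr : forall h : R -> R, ex_derive h y -> continuous h y)
          by (intros h; apply (@ex_derive_continuous R_AbsRing R_NormedModule)).
        assert (Hq4 : (1 + y + y ^ 2) ^ 2 <> 0) by (apply pow_nonzero, Hq).
        assert (Cm : continuous multiplier y)
          by (eapply continuous_derivable, is_derive_multiplier, Hy0).
        assert (Cw : continuous (fun x => weight_beta x * dlog_multiplier x) y).
        { apply Cr. unfold weight_beta, dlog_multiplier. simpl in Hq, Hq4.
          auto_derive. repeat split; lra. }
        assert (Ck : continuous
                       (fun x => 3 / 2 * (1 + 2 * x) / (1 + x + x ^ 2) ^ 2) y).
        { apply Cr. simpl in Hq4. auto_derive. lra. }
        apply (@continuous_mult _ R_AbsRing); [exact Cm|].
        apply (@continuous_minus _ R_AbsRing R_NormedModule);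
          [apply (@continuous_minus _ R_AbsRing R_NormedModule)|];
          repeat (assumption || apply (@continuous_mult _ R_AbsRing)).
    - unfold cubic_wronskian. rewrite Hphi, Hgam.
      (* The factor p (1 - p) of [weight_beta] kills the one term free of fluxes, at e = 0 and e = 1
         alike. *)
      replace (weight_beta e) with 0
        by (unfold weight_beta; destruct He; subst e; field).
      ring. }
  apply (null_derive_segment (fun y => g y / (multiplier y * f y))); intros x Hx.
  - assert (Hx' : Rmin e p <= x <= Rmax e p) by lra.
    apply cubic_quotient_derive; auto. apply Hc, Hx'.
  - destruct (Hc x Hx) as (Hfx & Cf & _ & Cg & _).
    pose proof (multiplier_pos x (Hcl x Hx)) as Hm.
    apply (@continuous_mult _ R_AbsRing); [exact Cg|].
    apply continuous_Rinv_comp; [|nra].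
    apply (@continuous_mult _ R_AbsRing); [|exact Cf].
    eapply continuous_derivable, is_derive_multiplier, Hcl, Hx.
Qed.

End Wronskian.

(** * The transformations based at 0 and at 1 *)

Lemma multiplier_0 : multiplier 0 = 1.
Proof.
  unfold multiplier. rewrite Rmult_0_r, Rplus_0_r, sqrt_1. field.
Qed.

Lemma multiplier_1 : multiplier 1 = sqrt 3.
Proof.
  unfold multiplier. replace (1 + 2 * 1) with 3 by ring.
  assert (0 < sqrt 3) by (apply sqrt_lt_R0; lra).
  pose proof (sqrt_sqrt 3 ltac:(lra)).
  apply Rmult_eq_reg_r with (sqrt 3); [|lra].
  rewrite H0. field. lra.
Qed.

Lemma continuous_gauss_comp (a b : R) (u : R -> R) (x l : R) :
  0 < a -> 0 < b -> a + b = 1 -> is_derive u x l -> 0 <= u x < 1 ->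
  continuous (fun y => hypergeom_2F1 a b 1 (u y)) x
  /\ continuous (fun y => gauss_flux a b (u y)) x.
Proof.
  intros Ha Hb Hab Hu Hx.
  assert (Rabs (u x) < 1) by (rewrite Rabs_pos_eq; lra).
  apply continuous_derivable in Hu.
  split; apply (continuous_comp u); try exact Hu.
  - apply continuous_gauss; assumption.
  - apply continuous_gauss_flux; assumption.
Qed.

Lemma is_derive_one_minus (u : R -> R) (x l : R) :
  is_derive u x l -> is_derive (fun y => 1 - u y) x (- l).
Proof.
  intros H. replace (- l) with (minus 0 l)
    by (unfold minus, plus, opp; simpl; ring).
  apply (is_derive_minus (fun _ => 1) u); [|exact H].
  apply @is_derive_const.
Qed.

Lemma cubic_transformation (p : R) : 0 < p < 1 ->
  F3 (cubic_beta p) = multiplier p * F2 (cubic_alpha p).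
Proof.
  intros Hp.
  pose proof (multiplier_pos p ltac:(lra)).
  assert (HF : 1 <= F2 (cubic_alpha p))
    by (apply gauss_ge_1; try lra; split;
        [apply alpha_ge_0 | apply alpha_lt_1]; lra).
  assert (Ha0 : cubic_alpha 0 = 0) by (unfold cubic_alpha; field).
  assert (Hb0 : cubic_beta 0 = 0) by (unfold cubic_beta; field).
  assert (E : F3 (cubic_beta p) / (multiplier p * F2 (cubic_alpha p)) = 1).
  { rewrite (cubic_quotient
      (fun x => F2 (cubic_alpha x)) (fun x => gauss_flux (1/2) (1/2) (cubic_alpha x))
      (fun x => F3 (cubic_beta x)) (fun x => gauss_flux (1/3) (2/3) (cubic_beta x)))
      with (e := 0); try assumption.
    - rewrite Ha0, Hb0, multiplier_0. unfold F2, F3. rewrite !gauss_0. field.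
    (* The constants 1/4 and 2/9 are the products a b for [F2] and [F3]. *)
    - replace (1 / 4) with (1 / 2 * (1 / 2)) by field.
      apply pullback_system_comp; try lra; intros x Hx.
      + apply is_derive_alpha; lra.
      + split; [apply alpha_gt_0 | apply alpha_lt_1]; lra.
      + apply alpha_weight; lra.
    - replace (2 / 9) with (1 / 3 * (2 / 3)) by field.
      apply pullback_system_comp; try lra; intros x Hx.
      + apply is_derive_beta; lra.
      + split; [apply beta_gt_0 | apply beta_lt_1]; lra.
      + apply beta_weight.
    - left; reflexivity.
    - intros x Hx. rewrite Rmin_left, Rmax_right in Hx by lra.
      assert (A : 0 <= cubic_alpha x < 1)
        by (split; [apply alpha_ge_0 | apply alpha_lt_1]; lra).
      assert (B : 0 <= cubic_beta x < 1)
        by (split; [apply beta_ge_0 | apply beta_lt_1; lra]).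
      destruct (continuous_gauss_comp (1/2) (1/2) cubic_alpha x (dalpha x))
        as [C1 C2]; try lra; [apply is_derive_alpha; lra|].
      destruct (continuous_gauss_comp (1/3) (2/3) cubic_beta x (dbeta x))
        as [C3 C4]; try lra; [apply is_derive_beta; lra|].
      repeat split; try assumption.
      apply Rlt_le_trans with 1; [lra|]. apply gauss_ge_1; lra.
    - rewrite Ha0. apply gauss_flux_0.
    - rewrite Hb0. apply gauss_flux_0. }
  apply Rmult_eq_reg_r with (/ (multiplier p * F2 (cubic_alpha p))).
  - rewrite Rinv_r by nra. exact E.
  - apply Rinv_neq_0_compat. nra.
Qed.

(** At the base point 1 the arguments 1 - alpha and 1 - beta vanish, so both series are 1 and both
    fluxes 0. The value of [multiplier] there supplies sqrt 3. *)
Lemma cubic_transformation_complementary (p : R) : 0 < p < 1 ->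
  sqrt 3 * F3 (1 - cubic_beta p) = multiplier p * F2 (1 - cubic_alpha p).
Proof.
  intros Hp.
  pose proof (multiplier_pos p ltac:(lra)).
  assert (0 < sqrt 3) by (apply sqrt_lt_R0; lra).
  assert (HF : 1 <= F2 (1 - cubic_alpha p)).
  { pose proof (alpha_gt_0 p). pose proof (alpha_lt_1 p).
    apply gauss_ge_1; lra. }
  assert (Ha1 : 1 - cubic_alpha 1 = 0) by (unfold cubic_alpha; field).
  assert (Hb1 : 1 - cubic_beta 1 = 0) by (unfold cubic_beta; field).
  assert (E : F3 (1 - cubic_beta p) / (multiplier p * F2 (1 - cubic_alpha p))
              = / sqrt 3).
  { rewrite (cubic_quotient
      (fun x => F2 (1 - cubic_alpha x))
      (fun x => - gauss_flux (1/2) (1/2) (1 - cubic_alpha x))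
      (fun x => F3 (1 - cubic_beta x))
      (fun x => - gauss_flux (1/3) (2/3) (1 - cubic_beta x)))
      with (e := 1); try assumption.
    - rewrite Ha1, Hb1, multiplier_1. unfold F2, F3. rewrite !gauss_0. field. lra.
    - replace (1 / 4) with (1 / 2 * (1 / 2)) by field.
      apply pullback_system_reflect.
      apply (pullback_system_comp _ _ (fun x => 1 - cubic_alpha x));
        try lra; intros x Hx.
      + apply is_derive_one_minus, is_derive_alpha; lra.
      + pose proof (alpha_gt_0 x). pose proof (alpha_lt_1 x). lra.
      + pose proof (alpha_weight x). lra.
    - replace (2 / 9) with (1 / 3 * (2 / 3)) by field.
      apply pullback_system_reflect.
      apply (pullback_system_comp _ _ (fun x => 1 - cubic_beta x));
        try lra; intros x Hx.
      + apply is_derive_one_minus, is_derive_beta; lra.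
      + pose proof (beta_gt_0 x). pose proof (beta_lt_1 x). lra.
      + pose proof (beta_weight x). lra.
    - right; reflexivity.
    - intros x Hx. rewrite Rmin_right, Rmax_left in Hx by lra.
      (* Here x = 1 is included, beyond the reach of [alpha_lt_1]; the factored form of 1 - alpha
         gives the weak inequality. *)
      assert (A : 0 <= 1 - cubic_alpha x < 1).
      { pose proof (alpha_gt_0 x). rewrite one_minus_alpha in * by lra.
        split; [apply Rle_mult_inv_pos; [apply Rmult_le_pos; [|apply pow_le]|]; lra|].
        rewrite <- one_minus_alpha; lra. }
      assert (B : 0 <= 1 - cubic_beta x < 1).
      { pose proof (beta_gt_0 x).
        split; [|lra]. rewrite one_minus_beta.
        apply Rle_mult_inv_pos; [apply pow2_ge_0|].
        apply Rmult_lt_0_compat; [lra|apply pow_lt; nra]. }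
      destruct (continuous_gauss_comp (1/2) (1/2) (fun y => 1 - cubic_alpha y) x
                  (- dalpha x)) as [C1 C2]; try lra;
        [apply is_derive_one_minus, is_derive_alpha; lra|].
      destruct (continuous_gauss_comp (1/3) (2/3) (fun y => 1 - cubic_beta y) x
                  (- dbeta x)) as [C3 C4]; try lra;
        [apply is_derive_one_minus, is_derive_beta; lra|].
      repeat split; try assumption;
        try (apply (@continuous_opp _ R_AbsRing R_NormedModule); assumption).
      apply Rlt_le_trans with 1; [lra|]. apply gauss_ge_1; lra.
    - rewrite Ha1, gauss_flux_0. ring.
    - rewrite Hb1, gauss_flux_0. ring. }
  assert (0 < multiplier p * F2 (1 - cubic_alpha p)) by nra.
  apply Rmult_eq_reg_r with
    (/ sqrt 3 * / (multiplier p * F2 (1 - cubic_alpha p))).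
  - transitivity (F3 (1 - cubic_beta p) / (multiplier p * F2 (1 - cubic_alpha p)));
      [field; nra|].
    rewrite E. field. nra.
  - apply Rmult_integral_contrapositive_currified; apply Rinv_neq_0_compat; lra.
Qed.

Theorem theorem8 (p alpha beta : R) (hp0 : 0 < p) (hp1 : p < 1)
  (halpha : alpha = p ^ 3 * (2 + p) / (1 + 2 * p))
  (hbeta : beta = 27 / 4 * (p ^ 2 * (1 + p) ^ 2 / (1 + p + p ^ 2) ^ 3)) :
  F2 (1 - alpha) / F2 alpha = sqrt 3 * (F3 (1 - beta) / F3 beta).
Proof.
  fold (cubic_alpha p) in halpha. fold (cubic_beta p) in hbeta. subst alpha beta.
  pose proof (multiplier_pos p ltac:(lra)) as Hm.
  assert (HF : 1 <= F2 (cubic_alpha p))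
    by (apply gauss_ge_1; try lra; split;
        [apply alpha_ge_0 | apply alpha_lt_1]; lra).
  transitivity (sqrt 3 * F3 (1 - cubic_beta p) / F3 (cubic_beta p)).
  (* Both transformations carry the same factor [multiplier p], which cancels. *)
  - rewrite cubic_transformation_complementary, cubic_transformation by lra.
    field. lra.
  - unfold Rdiv. ring.
Qed.
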